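(* Let $\mathcal{L}$ be a $\mathcal{J}$-subspace lattice on a Banach space $X$ over the real or complex field $\mathbb{F}$, and let $\mathrm{Alg}\mathcal{L}$ be the associated $\mathcal{J}$-subspace lattice algebra. Suppose $\{L_n\}_{n=0}^{\infty}$ is a family of linear mappings $L_n:\mathrm{Alg}\mathcal{L}\to\mathrm{Alg}\mathcal{L}$ with $L_0=\mathrm{id}$ such that, for every $n\ge 0$, $$L_n([A,B])=\sum_{i+j=n}[L_i(A),L_j(B)]$$ for all $A,B\in\mathrm{Alg}\mathcal{L}$ with $AB=0$. Then there is a sequence $\{\delta_n\}_{n=0}^{\infty}$ of linear mappings $\delta_n:\mathrm{Alg}\mathcal{L}\to\mathrm{Alg}\mathcal{L}$ satisfying $$\delta_n([A,F])=[\delta_n(A),F]+[A,\delta_n(F)]$$ for all $A\in\mathrm{Alg}\mathcal{L}$ and $F\in\mathcal{F}(\mathcal{L})$, such that $$(n+1)L_{n+1}=\sum_{k=0}^{n}L_{n-k}\delta_{k+1}$$ for each non-negative integer $n$.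
   Context: Subspaces in a lattice are closed. A family $\mathcal{L}$ of subspaces of a Banach space $X$ is a subspace lattice if it contains $\{0\}$ and $X$ and is closed under arbitrary closed linear spans $\bigvee$ and intersections $\bigwedge$. $\mathrm{Alg}\mathcal{L}$ is the algebra of all bounded linear operators on $X$ leaving every subspace in $\mathcal{L}$ invariant. For $K\in\mathcal{L}$ put $K_-=\bigvee\{L\in\mathcal{L}: K\nsubseteq L\}$, and let $\mathcal{J}(\mathcal{L})=\{K\in\mathcal{L}: K\ne\{0\}\text{ and }K_-\ne X\}$. $\mathcal{L}$ is a $\mathcal{J}$-subspace lattice if: (1) $\bigvee\{K: K\in\mathcal{J}(\mathcal{L})\}=X$; (2) $\bigwedge\{K_-: K\in\mathcal{J}(\mathcal{L})\}=\{0\}$; (3) $K\bigvee K_-=X$ for each $K\in\mathcal{J}(\mathcal{L})$; (4) $K\bigwedge K_-=\{0\}$ for each $K\in\mathcal{J}(\mathcal{L})$. Then $\mathrm{Alg}\mathcal{L}$ is called a $\mathcal{J}$-subspace lattice algebra. $[A,B]=AB-BA$; $\mathcal{F}(\mathcal{L})$ is the algebra of all finite rank operators in $\mathrm{Alg}\mathcal{L}$; products of mappings such as $L_{n-k}\delta_{k+1}$ denote composition. *)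

(* Defs.v *)
From HB Require Import structures.
From mathcomp Require Import all_boot all_order all_algebra.
From mathcomp Require Import all_classical all_reals all_analysis.
From mathcomp Require Import complex.

Set Implicit Arguments.
Unset Strict Implicit.
Unset Printing Implicit Defensive.

Import Order.TTheory GRing.Theory Num.Theory.
Import numFieldNormedType.Exports.

Local Open Scope classical_set_scope.
Local Open Scope ring_scope.

(* [A, B] = A B - B A *)
Definition lie_bracket (A : pzRingType) (a b : A) : A := a * b - b * a.

Section BoundedOperators.
Context {F : numFieldType} {X : normedModType F}.

(* By [linear_boundedP] the second condition says that |f x| <= r |x| for some
   r and all x. *)
Definition bounded_op : {pred X -> X} :=
  fun f => `[< linear f /\ bounded_near f (nbhs (0 : X)) >].

Let pack_linear (f : X -> X) (lf : linear f) : {linear X -> X} :=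
  HB.pack f (GRing.isLinear.Build _ _ _ _ f lf).

Lemma bounded_opP (f : X -> X) :
  reflect (linear f /\ continuous f) (f \in bounded_op).
Proof.
apply: (iffP idP) => [/asboolP[lf bf]|[lf cf]].
  split=> //; exact: (@bounded_linear_continuous _ _ _ (pack_linear lf)).
apply/asboolP; split=> //.
exact: (linear_bounded_continuous (pack_linear lf)).2.
Qed.

Lemma bounded_op_submod_closed : submod_closed bounded_op.
Proof.
split=> [|a f g /bounded_opP[lf cf] /bounded_opP[lg cg]]; apply/bounded_opP.
  split=> [a u v|]; first by rewrite scaler0 addr0.
  exact: cst_continuous.
split=> [b u v|x].
  by rewrite !fctE lf lg !scalerDr addrACA !scalerA mulrC.
apply: cvgD; last exact: cg.
by apply: cvgZr; exact: cf.
Qed.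

HB.instance Definition _ :=
  GRing.isSubmodClosed.Build _ _ bounded_op bounded_op_submod_closed.

Lemma bounded_op_id : (id : X -> X) \in bounded_op.
Proof. by apply/bounded_opP; split=> // x; exact: cvg_id. Qed.

Lemma bounded_op_comp (f g : X -> X) :
  f \in bounded_op -> g \in bounded_op -> f \o g \in bounded_op.
Proof.
move=> /bounded_opP[lf cf] /bounded_opP[lg cg]; apply/bounded_opP; split.
  by move=> a u v; rewrite /= lg lf.
by move=> x; apply: continuous_comp; [exact: cg|exact: cf].
Qed.

End BoundedOperators.

Arguments bounded_op {F} X.

(* B(X), with composition as its product; it is only a possibly-zero ring
   because X may be the zero space. *)
Record bop (F : numFieldType) (X : normedModType F) := Bop {
  bop_fun :> X -> X;
  bop_funP : bop_fun \in bounded_op X }.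

Section BopAlgebra.
Context {F : numFieldType} {X : normedModType F}.

HB.instance Definition _ := [isSub of bop X for @bop_fun F X].
HB.instance Definition _ := [Choice of bop X by <:].
HB.instance Definition _ := [SubChoice_isSubLmodule of bop X by <:].

Lemma bop_linear (f : bop X) : linear f.
Proof. by have /bounded_opP[] := bop_funP f. Qed.

HB.instance Definition _ (f : bop X) :=
  GRing.isLinear.Build _ _ _ _ (bop_fun f) (bop_linear f).

Definition bop_one : bop X := Bop bounded_op_id.
Definition bop_mul (f g : bop X) : bop X :=
  Bop (bounded_op_comp (bop_funP f) (bop_funP g)).

Lemma bopP (f g : bop X) : (forall x, f x = g x) -> f = g.
Proof. by move=> fg; apply/val_inj/funext. Qed.

Let mulA : associative bop_mul. Proof. by move=> f g h; exact: bopP. Qed.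
Let mul1 : left_id bop_one bop_mul. Proof. by move=> f; exact: bopP. Qed.
Let mulr1 : right_id bop_one bop_mul. Proof. by move=> f; exact: bopP. Qed.
Let mulDl : left_distributive bop_mul +%R.
Proof. by move=> f g h; exact: bopP. Qed.
Let mulDr : right_distributive bop_mul +%R.
Proof. by move=> f g h; apply: bopP => x; exact: linearD. Qed.

HB.instance Definition _ :=
  GRing.Zmodule_isPzRing.Build (bop X) mulA mul1 mulr1 mulDl mulDr.

Lemma bop_scalerAl (a : F) (f g : bop X) : a *: (f * g) = (a *: f) * g.
Proof. exact: bopP. Qed.

Lemma bop_scalerAr (a : F) (f g : bop X) : a *: (f * g) = f * (a *: g).
Proof. by apply: bopP => x; rewrite [RHS](linearZ_LR (bop_fun f)). Qed.

End BopAlgebra.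

Section SubspaceLattices.
Context {F : numFieldType} {X : normedModType F}.
Implicit Types (V K : set X) (LL FF : set (set X)).

Definition closed_subspace V : Prop :=
  [/\ closed V, V 0 & forall (a : F) u v, V u -> V v -> V (a *: u + v)].

Definition lin_span (A : set X) : set X :=
  [set x | exists (n : nat) (c : 'I_n -> F) (v : 'I_n -> X),
    (forall i, A (v i)) /\ x = \sum_i c i *: v i].

Definition join FF : set X := closure (lin_span (\bigcup_(V in FF) V)).

Definition meet FF : set X := \bigcap_(V in FF) V.

Definition subspace_lattice LL : Prop :=
  [/\ LL `<=` closed_subspace,
      LL [set 0],
      LL setT,
      forall FF, FF `<=` LL -> LL (join FF)
    & forall FF, FF `<=` LL -> LL (meet FF)].

End SubspaceLattices.

Record subspaceLattice (F : numFieldType) (X : normedModType F) :=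
  SubspaceLattice {
    subspaces : set (set X);
    subspacesP : subspace_lattice subspaces }.

Section JSubspaceLattices.
Context {F : numFieldType} {X : normedModType F}.
Implicit Types (K : set X) (LL : subspaceLattice X).

(* K_- *)
Definition lower LL K : set X := join [set V | subspaces LL V /\ ~ (K `<=` V)].

(* J(L) *)
Definition Jset LL : set (set X) :=
  [set K | [/\ subspaces LL K, K <> [set 0] & lower LL K <> setT]].

Definition J_subspace_lattice LL : Prop :=
  [/\ join (Jset LL) = setT,
      meet [set lower LL K | K in Jset LL] = [set 0],
      forall K, Jset LL K -> join [set K; lower LL K] = setT
    & forall K, Jset LL K -> meet [set K; lower LL K] = [set 0]].

Definition leaves_invariant LL : {pred bop X} :=
  fun T => `[< forall V, subspaces LL V -> forall x, V x -> V (T x) >].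

Lemma leaves_invariant_submod_closed LL : submod_closed (leaves_invariant LL).
Proof.
have [subLL _ _ _ _] := subspacesP LL.
split=> [|a S T /asboolP LS /asboolP LT]; apply/asboolP => V LV x Vx;
  have [_ V0 linV] := subLL V LV; first exact: V0.
by apply: linV; [exact: LS|exact: LT].
Qed.

Lemma leaves_invariant_mulr_closed LL : mulr_closed (leaves_invariant LL).
Proof.
split=> [|S T /asboolP LS /asboolP LT]; apply/asboolP => V LV x Vx //.
by apply: LS => //; exact: LT.
Qed.

HB.instance Definition _ LL :=
  GRing.isSubmodClosed.Build F (bop X) (leaves_invariant LL)
    (leaves_invariant_submod_closed LL).
HB.instance Definition _ LL :=
  GRing.isMulClosed.Build (bop X) (leaves_invariant LL)
    (leaves_invariant_mulr_closed LL).

End JSubspaceLattices.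

(* Alg L, as a subalgebra of B(X) *)
Record Alg (F : numFieldType) (X : normedModType F) (LL : subspaceLattice X) :=
  MkAlg {
    alg_op :> bop X;
    alg_opP : alg_op \in leaves_invariant LL }.

Section AlgAlgebra.
Context {F : numFieldType} {X : normedModType F} {LL : subspaceLattice X}.

HB.instance Definition _ := [isSub of Alg LL for @alg_op F X LL].
HB.instance Definition _ := [Choice of Alg LL by <:].
HB.instance Definition _ :=
  GRing.SubChoice_isSubPzRing.Build (bop X) (leaves_invariant LL) (Alg LL)
    (subringClosedP (leaves_invariant LL)).
HB.instance Definition _ := [SubZmodule_isSubLmodule of Alg LL by <:].

(* The elements of F(L): the range lies in the span of finitely many vectors. *)
Definition finite_rank (T : Alg LL) : Prop :=
  exists (n : nat) (e : 'I_n -> X), forall x, exists c : 'I_n -> F,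
    T x = \sum_i c i *: e i.

End AlgAlgebra.

Arguments Alg {F X} LL.

(* Main.v *)
From HB Require Import structures.
Require Import Defs.
From mathcomp Require Import all_boot all_order all_algebra.
From mathcomp Require Import all_classical all_reals all_analysis.
From mathcomp Require Import complex.
From mathcomp Require Import ring lra.
Import Order.TTheory GRing.Theory Num.Theory numFieldNormedType.Exports.
Local Open Scope classical_set_scope.
Local Open Scope ring_scope.

(** Measure the failure of the higher Leibniz rule by the bilinear map
    E_n(A, B) = L_n [A, B] - sum_(i <= n) [L_i A, L_(n - i) B], which is
    skew-symmetric and vanishes when A B = 0. For an idempotent P of the
    algebra the zero products A P (1 - P) B and A (1 - P) P B give
    E_n(A P, B) = E_n(A, P B) [defect_idem]. So if T is a combination of
    idempotents, E_n(A, T) = E_n(A T, 1); and when the same holds of A T, then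
    E_n(A T, 1) = E_n(1, A T) = - E_n(A T, 1), whence E_n(A, T) = 0. Every
    finite rank T in Alg L is such a combination: the Leibniz rule therefore
    holds as soon as one argument has finite rank [defect_finite_rank].

    That finite rank operators are combinations of idempotents
    [finite_rank_ind] rests on functionals: if K is in J(L) and y <> 0 is in K,
    then y is not in K_-, since K and K_- meet in 0, so some continuous g
    vanishes on K_- and has g y = 1, and the idempotent x |-> g x *: y lies in
    Alg L. The separation of y from K_- is the Hahn-Banach theorem, proved
    below by way of minimal sublinear functionals, then transferred to complex
    scalars.

    The recursion (n+1) L_(n+1) = sum_k L_(n-k) d_k determines maps d_k
    [log_derivative]: with generating series, L' = L d, so d is the logarithmic
    derivative of L. Differentiating L [A, T] = [L A, L T] for T of finite rank
    gives L (d [A, T]) = [L (d A), L T] + [L A, L (d T)]. Here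
    [L (d A), L T] = L [d A, T] because T has finite rank, but d T need not
    have finite rank. However, if d is a Lie derivation on finite rank
    operators and P is a rank-one idempotent, then d P is the sum of a finite
    rank and a central operator [lie_derivation_idem], and the L_n preserve
    the centre [central_image]; so E_n(A, d T) = 0 [defect_derivation]. This
    information about d_k for k < n is just what the step to d_n requires
    [log_derivative_lie]. *)

Set Implicit Arguments.
Unset Strict Implicit.
Unset Printing Implicit Defensive.

(** * Sublinear functionals and the Hahn-Banach theorem *)

Section HahnBanach.
Context {R : realType} {V : lmodType R}.
Implicit Types (p q : V -> R) (G : set (V -> R)) (S : set (V * R)).

Definition sublinear q : Prop :=
  (forall x y, q (x + y) <= q x + q y) /\
  (forall t x, 0 < t -> q (t *: x) <= t * q x).

Lemma sublinear0 q : sublinear q -> q 0 = 0.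
Proof.
move=> [qD qZ]; have := qD 0 0; rewrite addr0.
by have := qZ 2^-1 0 ltac:(lra); rewrite scaler0; lra.
Qed.

Lemma sublinear_oppr q x : sublinear q -> - q (- x) <= q x.
Proof.
move=> sq; have := sq.1 x (- x).
by rewrite subrr (sublinear0 sq); lra.
Qed.

(** Infima of families that are closed in this weak sense are sublinear; the
    two uses are chains (for Zorn's lemma) and the translates of a functional
    along a cone. *)
Lemma sublinear_inf G : G !=set0 ->
    (forall x, has_lbound [set f x | f in G]) ->
    (forall f g x y, G f -> G g -> exists2 h, G h & h (x + y) <= f x + g y) ->
    (forall t f x, 0 < t -> G f -> exists2 h, G h & h (t *: x) <= t * f x) ->
  sublinear (fun x => inf [set f x | f in G]).
Proof.
move=> [f0 Gf0] lbG GD GZ.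
have le_inf f x : G f -> inf [set f x | f in G] <= f x.
  by move=> Gf; apply: ge_inf; [exact: lbG|exists f].
have ne x : [set f x | f in G] !=set0 by exists (f0 x), f0.
split=> [x y|t x t0] /=.
  rewrite -lerBlDr; apply: (lb_le_inf (ne x)) => _ [f Gf <-].
  rewrite lerBlDl -lerBlDr; apply: (lb_le_inf (ne y)) => _ [g Gg <-].
  have [h Gh hfg] := GD f g x y Gf Gg.
  by have := le_inf h (x + y) Gh; lra.
rewrite -ler_pdivrMl //; apply: (lb_le_inf (ne x)) => _ [f Gf <-].
have [h Gh hf] := GZ t f x t0 Gf.
by rewrite ler_pdivrMl //; exact: le_trans (le_inf h _ Gh) _.
Qed.

(** A convex cone of prescriptions: a pair (c, s) asks for a functional that is
    at least s at c. *)
Definition pair_cone S : Prop :=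
  [/\ S (0, 0),
      forall u v, S u -> S v -> S (u.1 + v.1, u.2 + v.2)
    & forall t u, 0 < t -> S u -> S (t *: u.1, t * u.2)].

(** The functional q' x = inf {q (x + c) - s : (c, s) in S} works; it is finite
    because q (x + c) - s >= q c - s - q (- x) >= - q (- x). *)
Lemma sublinear_below_cone q S : sublinear q -> pair_cone S ->
    (forall u, S u -> u.2 <= q u.1) ->
  exists q', [/\ sublinear q', forall x, q' x <= q x
               & forall u, S u -> q' (- u.1) <= - u.2].
Proof.
move=> sq [S0 SD SZ] Sq.
pose G := [set (fun x => q (x + u.1) - u.2) | u in S].
have lbG x : has_lbound [set f x | f in G].
  exists (- q (- x)) => _ [_ [u Su <-] <-].
  have := Sq _ Su; have := sq.1 (- x) (x + u.1).
  by rewrite addKr; lra.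
have le_inf u x : S u -> inf [set f x | f in G] <= q (x + u.1) - u.2.
  by move=> Su; apply: ge_inf => //; eexists; [exists u|].
exists (fun x => inf [set f x | f in G]); split.
- apply: sublinear_inf => //.
  + by eexists; exists (0, 0).
  + move=> _ _ x y [u Su <-] [v Sv <-]; eexists.
      by exists (u.1 + v.1, u.2 + v.2); first exact: SD.
    by rewrite /= addrACA; have := sq.1 (x + u.1) (y + v.1); lra.
  + move=> t _ x t0 [u Su <-]; eexists.
      by exists (t *: u.1, t * u.2); first exact: SZ.
    by rewrite /= -scalerDr; have := sq.2 t (x + u.1) t0; lra.
- by move=> x; have := le_inf _ x S0; rewrite /= addr0 subr0.
- move=> u Su; have := le_inf _ (- u.1) Su.
  by rewrite addNr (sublinear0 sq) sub0r.
Qed.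

Lemma minimal_sublinear q : sublinear q ->
  exists m, [/\ sublinear m, forall x, m x <= q x
    & forall m', sublinear m' -> (forall x, m' x <= m x) -> m' = m].
Proof.
move=> sq.
pose P (m : V -> R) := sublinear m /\ forall x, m x <= q x.
pose T := {m | P m}.
pose below (m m' : T) := `[< forall x, sval m' x <= sval m x >].
have [| | |A totA|[m [sm mq]] minm] := @Zorn T below.
- by move=> m; apply/asboolP.
- move=> m1 m2 m3 /asboolP m12 /asboolP m23; apply/asboolP => x.
  exact: le_trans (m23 x) (m12 x).
- move=> [m1 P1] [m2 P2] /asboolP m12 /asboolP m21; apply: eq_exist.
  by apply/funext => x; apply/le_anti; rewrite m12 m21.
- have [[m0 Am0]|A0] := pselect (A !=set0); last first.
    exists (exist P q (conj sq (fun x => lexx _))) => m Am.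
    by case: A0; exists m.
  pose G := [set sval m | m in A].
  have lbG x : has_lbound [set f x | f in G].
    exists (- q (- x)) => _ [_ [m Am <-] <-].
    have [sm mq] := svalP m.
    apply: le_trans (sublinear_oppr x sm); rewrite lerN2; exact: mq.
  have le_inf m x : A m -> inf [set f x | f in G] <= sval m x.
    by move=> Am; apply: ge_inf => //; exists (sval m) => //; exists m.
  have sinf : sublinear (fun x => inf [set f x | f in G]).
    apply: sublinear_inf => //.
    + by exists (sval m0), m0.
    + move=> _ _ x y [m Am <-] [m' Am' <-].
      have [/asboolP le|/asboolP le] := totA _ _ Am Am'.
        exists (sval m'); first by exists m'.
        by have := (svalP m').1.1 x y; have := le x; lra.
      exists (sval m); first by exists m.
      by have := (svalP m).1.1 x y; have := le y; lra.
    + move=> t _ x t0 [m Am <-]; exists (sval m); first by exists m.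
      exact: (svalP m).1.2.
  have infq x : inf [set f x | f in G] <= q x.
    exact: le_trans (le_inf _ x Am0) ((svalP m0).2 x).
  exists (exist P _ (conj sinf infq)) => m Am.
  by apply/asboolP => x /=; exact: le_inf.
exists m; split=> // m' sm' m'm.
have m'q x : m' x <= q x by exact: le_trans (m'm x) (mq x).
have /(_ _)/(congr1 sval)/= := minm (exist P m' (conj sm' m'q)).
by apply; apply/asboolP.
Qed.

(** Lowering m along the ray of a, with the prescription m a at a, gives a
    sublinear functional below m, hence m itself by minimality; at - a it yields
    m (- a) <= - m a. Odd sublinear functionals are linear. *)
Lemma minimal_sublinear_scalar m : sublinear m ->
    (forall m', sublinear m' -> (forall x, m' x <= m x) -> m' = m) ->
  scalar m.
Proof.
move=> sm minm.
have mN a : m (- a) = - m a.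
  pose S := [set u : V * R | exists2 t, 0 <= t & u = (t *: a, t * m a)].
  have m0 := sublinear0 sm.
  have [|_ [t t0 ->]|m' [sm' m'm m'a]] := sublinear_below_cone (S := S) sm.
  - split.
    + by exists 0; rewrite ?scale0r ?mul0r.
    + move=> _ _ [s s0 ->] [t t0 ->]; exists (s + t); first exact: addr_ge0.
      by rewrite /= scalerDl mulrDl.
    + move=> s _ s0 [t t0 ->]; exists (s * t); first by rewrite mulr_ge0 // ltW.
      by rewrite /= scalerA mulrA.
  - move: t0; rewrite le_eqVlt => /orP[/eqP<-|t0] /=.
      by rewrite scale0r mul0r m0.
    have ti0 : 0 < t^-1 by rewrite invr_gt0.
    have := sm.2 t^-1 (t *: a) ti0.
    by rewrite scalerA mulVf ?gt_eqF // scale1r ler_pdivlMl.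
  - have /= := m'a (a, m a); rewrite (minm _ sm' m'm) => /(_ _) le.
    apply/le_anti/andP; split.
      by apply: le; exists 1; rewrite ?scale1r ?mul1r.
    by have := sublinear_oppr (- a) sm; rewrite opprK; lra.
have mD x y : m (x + y) = m x + m y.
  apply/le_anti/andP; split; first exact: sm.1.
  by rewrite -lerN2 opprD -!mN opprD; exact: sm.1.
have mpZ t x : 0 < t -> m (t *: x) = t * m x.
  move=> t0; apply/le_anti/andP; split; first exact: sm.2.
  by rewrite -lerN2 -mulrN -!mN -scalerN; exact: sm.2.
move=> t x y; rewrite mD; congr (_ + _).
have [t0|t0|->] := ltrgt0P t; first exact: mpZ.
  apply: oppr_inj; rewrite -mN -scaleNr -mulNr; apply: mpZ.
  by rewrite oppr_gt0.
by rewrite scale0r mul0r sublinear0.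
Qed.

(** Hahn-Banach in the form of Mazur and Orlicz: a minimal sublinear functional
    below the one adapted to S is linear and meets the prescriptions. *)
Lemma mazur_orlicz p S : sublinear p -> pair_cone S ->
    (forall u, S u -> u.2 <= p u.1) ->
  exists g : V -> R, [/\ scalar g, forall x, g x <= p x
                       & forall u, S u -> u.2 <= g u.1].
Proof.
move=> sp cS Sp.
have [q [sq qp qS]] := sublinear_below_cone sp cS Sp.
have [g [sg gq ming]] := minimal_sublinear sq.
have lg := minimal_sublinear_scalar sg ming.
exists g; split=> // [x|u Su]; first exact: le_trans (gq x) (qp x).
rewrite -lerN2; apply: le_trans (qS u Su); apply: le_trans (gq _).
have := lg (-1) u.1 0.
by rewrite scaleN1r addr0 (sublinear0 sg) addr0 mulN1r => ->.
Qed.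

(** The prescriptions are t * eps at t *: y + w, for t >= 0 and w in W; they lie
    below N because the distance from y to W is at least eps. Those at the
    vectors of W force g to be nonnegative on a subspace, hence zero there. *)
Lemma separating_functional (N : V -> R) (W : set V) (y : V) (eps : R) :
    (forall u v, N (u + v) <= N u + N v) ->
    (forall t u, N (t *: u) = `|t| * N u) ->
    W 0 -> (forall a u v, W u -> W v -> W (a *: u + v)) ->
    0 < eps -> (forall w, W w -> eps <= N (y - w)) ->
  exists g : V -> R, [/\ scalar g, forall x, `|g x| <= N x,
    forall w, W w -> g w = 0 & 0 < g y].
Proof.
move=> ND NZ W0 Wlin eps0 dist.
have WZ a u : W u -> W (a *: u).
  by move=> Wu; rewrite -[_ *: _]addr0; exact: Wlin.
have WD u v : W u -> W v -> W (u + v).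
  by move=> Wu Wv; rewrite -[u]scale1r; exact: Wlin.
have N0 : N 0 = 0 by rewrite -(scale0r 0) NZ normr0 mul0r.
have NN u : N (- u) = N u by rewrite -scaleN1r NZ normrN1 mul1r.
have sN : sublinear N.
  by split=> // t x t0; rewrite NZ gtr0_norm.
have N_ge0 u : 0 <= N u.
  by have := sublinear_oppr u sN; rewrite NN; lra.
pose S := [set u : V * R | exists t w,
  [/\ 0 <= t, W w & u = (t *: y + w, t * eps)]].
have cS : pair_cone S.
  split.
  - by exists 0, 0; rewrite scale0r addr0 mul0r.
  - move=> _ _ [s [w [s0 Ww ->]]] [t [w' [t0 Ww' ->]]].
    exists (s + t), (w + w'); split; [exact: addr_ge0|exact: WD|].
    by rewrite /= scalerDl mulrDl addrACA.
  - move=> r _ r0 [t [w [t0 Ww ->]]]; exists (r * t), (r *: w).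
    split; [by rewrite mulr_ge0 // ltW|exact: WZ|].
    by rewrite /= scalerDr scalerA mulrA.
have [_ [t [w [t0 Ww ->]]]|g [lg gN gS]] := mazur_orlicz sN cS.
  move: t0; rewrite le_eqVlt => /orP[/eqP<-|t0] /=; first by rewrite mul0r.
  have -> : t *: y + w = t *: (y - (- t^-1) *: w).
    by rewrite scalerBr scalerA mulrN divff ?gt_eqF // scaleN1r opprK.
  rewrite NZ gtr0_norm // ler_pM2l //; exact/dist/WZ.
have gNx x : g (- x) = - g x.
  by have := lg (-1) x (- 0); rewrite scaleN1r oppr0 addr0 mulN1r => ->;
     have := lg 1 0 0; rewrite scale1r addr0 mul1r; lra.
have g_ge0 w : W w -> 0 <= g w.
  move=> Ww; apply: (gS (w, 0)); exists 0, w.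
  by rewrite scale0r add0r mul0r.
exists g; split=> // [x|w Ww|].
- by rewrite ler_norml lerNl -gNx gN -(NN x) gN.
- have := g_ge0 _ Ww; have := g_ge0 _ (WZ (-1) w Ww).
  by rewrite scaleN1r gNx; lra.
- apply: lt_le_trans eps0 _; apply: (gS (y, eps)); exists 1, 0.
  by rewrite scale1r addr0 mul1r.
Qed.

End HahnBanach.

(** * Separating a point from a closed subspace *)

Section Annihilator.
Context {F : numFieldType} {X : normedModType F}.
Implicit Types (W : set X) (g : X -> F).

Definition annihilates g W : Prop :=
  [/\ scalar g, continuous g & forall w, W w -> g w = 0].

Lemma bounded_scalar_continuous g (C : F) : 0 <= C ->
  scalar g -> (forall x, `|g x| <= C * `|x|) -> continuous g.
Proof.
move=> C0 lg gC.
pose lin : {linear X -> F^o} :=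
  HB.pack (g : X -> F^o) (GRing.isLinear.Build F X F^o *:%R g lg).
suff : continuous lin by [].
apply: bounded_linear_continuous; apply/linear_boundedP.
near=> r => x; apply: le_trans (gC x) _.
apply: ler_wpM2r => //.
by near: r; apply: nbhs_pinfty_ge; rewrite ger0_real.
Unshelve. all: by end_near. Qed.

Lemma closed_dist W y : closed W -> ~ W y ->
  exists2 eps : F, 0 < eps & forall w, W w -> eps <= `|y - w|.
Proof.
move=> cW Wy; have oW := closed_openC cW.
have /nbhs_normP[eps /= eps0 sub] : nbhs y (~` W) by exact: open_nbhs_nbhs.
exists eps => // w Ww.
rewrite real_leNgt ?normr_real ?gtr0_real //.
by apply/negP => lt; apply: (sub w).
Qed.

Lemma normalize_annihilator g W y : annihilates g W -> g y != 0 ->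
  exists2 h, annihilates h W & h y = 1.
Proof.
move=> [lg cg gW] gy; exists (fun x => (g y)^-1 * g x); last exact: mulVf.
split=> [a u v|x|w Ww]; last by rewrite (gW w) // mulr0.
  by rewrite lg mulrDr mulrCA.
by apply: cvgM; [exact: cvg_cst|exact: cg].
Qed.

End Annihilator.

Lemma real_separation (R : realType) (X : normedModType R) (W : set X) y :
  closed_subspace W -> ~ W y -> exists2 g, annihilates g W & g y = 1.
Proof.
move=> [cW W0 Wlin] Wy; have [eps eps0 dist] := closed_dist cW Wy.
have [||g [lg gN gW gy]] := separating_functional (N := fun x : X => `|x|)
    _ _ W0 Wlin eps0 dist.
- exact: ler_normD.
- exact: normrZ.
apply: (@normalize_annihilator _ _ g); last by rewrite gt_eqF.
split=> //; apply: (bounded_scalar_continuous (C := 1)) => // x.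
by rewrite mul1r.
Qed.

Section Realification.
Context {R : realType}.
Local Open Scope complex_scope.

(** An alias that carries the real module structure of a complex space. *)
Definition realification (X : Type) : Type := X.

HB.instance Definition _ (X : lmodType R[i]) :=
  GRing.Zmodule.on (realification X).

Section Scale.
Variable X : lmodType R[i].
Let scale (a : R) (x : realification X) : realification X := a%:C *: (x : X).
Let scaleA a b x : scale a (scale b x) = scale (a * b) x.
Proof. by rewrite /scale scalerA -rmorphM. Qed.
Let scale1 : left_id 1 scale.
Proof. by move=> x; rewrite /scale scale1r. Qed.
Let scaleDr : right_distributive scale +%R.
Proof. by move=> a x y; rewrite /scale scalerDr. Qed.
Let scaleDl v : {morph scale^~ v : a b / a + b}.
Proof. by move=> a b; rewrite /scale rmorphD scalerDl. Qed.
HB.instance Definition _ := GRing.Zmodule_isLmodule.Build R (realification X)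
  scaleA scale1 scaleDr scaleDl.
End Scale.

Lemma normc_real (a : R) : `|a%:C| = `|a|%:C.
Proof. by rewrite normc_def /= expr0n addr0 sqrtr_sqr. Qed.

(** A real functional g that is dominated by the norm and vanishes on W is the
    real part of the complex functional x |-> g x - i g (i x), which vanishes on
    W because W is stable under multiplication by i. *)
Lemma complex_separation (X : normedModType R[i]) (W : set X) y :
  closed_subspace W -> ~ W y -> exists2 g, annihilates g W & g y = 1.
Proof.
move=> [cW W0 Wlin] Wy; have [eps eps0 dist] := closed_dist cW Wy.
pose N (x : realification X) : R := complex.Re `|x : X|.
have NE (x : X) : `|x| = (N x)%:C by rewrite /N RRe_real // normr_real.
have epsE : eps = (complex.Re eps)%:C by rewrite RRe_real // gtr0_real.
have [||||||g [lg gN gW gy]] := separating_functional (V := realification X)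
    (N := N) (W := W) (y := y) (eps := complex.Re eps).
- by move=> u v; rewrite -lecR rmorphD /= -!NE; exact: ler_normD.
- by move=> t u; apply: complexI; rewrite rmorphM /= -!NE normrZ normc_real.
- by [].
- by move=> a u v Wu Wv; exact: Wlin.
- by rewrite -ltcR -epsE.
- by move=> w Ww; rewrite -lecR -epsE -NE; exact: dist.
pose G (x : X) : R[i] := g x +i* - g ('i *: x).
have gcomb (a b : R) (u v w : X) :
    g (a%:C *: u + (b%:C *: v + w)) = a * g u + (b * g v + g w).
  by rewrite -[b * _ + _]lg -lg.
have scaleE (a : R[i]) (u v : X) :
    a *: u + v = (complex.Re a)%:C *: u + ((complex.Im a)%:C *: ('i *: u) + v).
  by rewrite addrA scalerA -scalerDl mulrC -complexE.
have lG : scalar G.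
  move=> a u v; apply/eqP; rewrite eq_complex /=; apply/andP; split; apply/eqP.
    by rewrite scaleE gcomb; case: a => a b /=; ring.
  have -> : 'i *: (a *: u + v)
      = (- complex.Im a)%:C *: u
        + ((complex.Re a)%:C *: ('i *: u) + 'i *: v) :> X.
    rewrite addrA !scalerA -scalerDl scalerDr scalerA; congr (_ *: _ + _).
    by case: a => a b; apply/eqP; rewrite eq_complex /=; apply/andP; split;
       apply/eqP; ring.
  by rewrite gcomb; case: a => a b /=; ring.
have GN x : `|G x| <= 2 * `|x|.
  rewrite [G x]complexE /=; apply: le_trans (ler_normD _ _) _.
  rewrite mulr_natl mulr2n; apply: lerD; first by rewrite normc_real NE lecR.
  have i1 : `|'i : R[i]| = 1 by rewrite normc_def /= expr0n add0r expr1n sqrtr1.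
  rewrite normrM i1 mul1r normc_real normrN -[leRHS]mul1r -i1 -normrZ NE lecR.
  exact: gN.
apply: (@normalize_annihilator _ _ G); last first.
  by apply/eqP => /(congr1 (@complex.Re R)) /= gy0; rewrite gy0 ltxx in gy.
split=> //.
  by apply: (bounded_scalar_continuous (C := 2) _ lG GN); rewrite ler0n.
move=> w Ww; rewrite /G gW // gW ?oppr0 //.
by rewrite -[_ *: _]addr0; exact: Wlin.
Qed.

End Realification.

Lemma separation (R : realType) (F : numFieldType)
    (hF : F = R :> numFieldType \/ F = R[i] :> numFieldType)
    (X : normedModType F) (W : set X) y :
  closed_subspace W -> ~ W y -> exists2 g, annihilates g W & g y = 1.
Proof.
by case: hF => hF; subst F; [exact: real_separation|exact: complex_separation].
Qed.

(** * Rank-one operators in a J-subspace lattice algebra *)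

Section AlgTheory.
Context {F : numFieldType} {X : normedModType F} {LL : subspaceLattice X}.
Implicit Types (A B T : Alg LL) (x y : X) (a : F).

Lemma algP A B : (forall x, A x = B x) -> A = B.
Proof. by move=> AB; apply/val_inj/bopP. Qed.

Lemma alg0E x : (0 : Alg LL) x = 0. Proof. by []. Qed.
Lemma algDE A B x : (A + B) x = A x + B x. Proof. by []. Qed.
Lemma algNE A x : (- A) x = - A x. Proof. by []. Qed.
Lemma algZE a A x : (a *: A) x = a *: A x. Proof. by []. Qed.
Lemma algME A B x : (A * B) x = A (B x). Proof. by []. Qed.
Lemma alg1E x : (1 : Alg LL) x = x. Proof. by []. Qed.
Definition algE := (alg0E, algDE, algNE, algZE, algME, alg1E).

Lemma alg_op_comb a A x y : A (a *: x + y) = a *: A x + A y.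
Proof. exact: bop_linear. Qed.
Lemma alg_op0 A : A 0 = 0. Proof. exact: (linear0 (alg_op A)). Qed.
Lemma alg_opZ a A x : A (a *: x) = a *: A x.
Proof. by rewrite -[_ *: x]addr0 alg_op_comb alg_op0 addr0. Qed.
Lemma alg_opD A x y : A (x + y) = A x + A y.
Proof. by rewrite -[x]scale1r alg_op_comb !scale1r. Qed.

Lemma alg_scalerAl a A B : (a *: A) * B = a *: (A * B).
Proof. exact: algP. Qed.

Lemma alg_scalerAr a A B : A * (a *: B) = a *: (A * B).
Proof. by apply: algP => x; rewrite !algE alg_opZ. Qed.

Lemma alg_continuous A : continuous A.
Proof. by have /bounded_opP[] := bop_funP A. Qed.

Lemma alg_invariant A V x : subspaces LL V -> V x -> V (A x).
Proof. by move=> LV; have /asboolP/(_ V LV x) := alg_opP A. Qed.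

Lemma ker_closed_subspace A : closed_subspace [set x | A x = 0].
Proof.
split=> [||a u v /= Au Av]; last 2 first.
- exact: alg_op0.
- by rewrite alg_op_comb Au Av scaler0 addr0.
have -> : [set x | A x = 0] = A @^-1` [set 0] by [].
apply: preimage_closed => [x _|]; first exact: alg_continuous.
exact/accessible_closed_set1/hausdorff_accessible/norm_hausdorff.
Qed.


Lemma join_sub (FF : set (set X)) (W : set X) : closed_subspace W ->
  (forall V, FF V -> V `<=` W) -> join FF `<=` W.
Proof.
move=> [cW W0 Wlin] FFW; rewrite /join ((closure_id W).1 cW); apply: closureS.
move=> _ [n [c [v [vF ->]]]].
elim/big_ind: _ => // [u w Wu Ww|i _].
  by rewrite -[u]scale1r; exact: Wlin.
rewrite -[_ *: _]addr0; apply: Wlin => //.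
by have [V FV Vv] := vF i; exact: FFW FV _ Vv.
Qed.

Lemma sub_join (FF : set (set X)) V : FF V -> V `<=` join FF.
Proof.
move=> FV x Vx; apply: subset_closure; exists 1%N, (fun=> 1), (fun=> x).
by split=> [_|]; [exists V|rewrite big_ord1 scale1r].
Qed.

Lemma lower_mem K : subspaces LL (lower LL K).
Proof. by have [_ _ _ + _] := subspacesP LL; apply=> V []. Qed.

Lemma member_closed V : subspaces LL V -> closed_subspace V.
Proof. by have [+ _ _ _ _] := subspacesP LL; apply. Qed.

End AlgTheory.

Lemma corner_commute (A : pzRingType) (P Q G D E : A) :
    Q * P = 0 -> P * Q = 0 -> Q * G = G -> G * Q = G ->
    lie_bracket E P + lie_bracket G D = 0 ->
  Q * D * Q * G = G * (Q * D * Q).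
Proof.
rewrite /lie_bracket => QP PQ QG GQ EPGD.
have compress0 : Q * (E * P - P * E) * Q = 0.
  by rewrite mulrBr mulrBl mulrA (mulrA Q P) QP mul0r -mulrA PQ mulr0
     mul0r subrr.
have compressG : Q * (G * D - D * G) * Q = G * D * Q - Q * D * G.
  by rewrite mulrBr mulrBl !mulrA QG -(mulrA (Q * D)) GQ.
have := congr1 (fun S => Q * S * Q) EPGD.
rewrite mulr0 mul0r mulrDr mulrDl compress0 add0r compressG.
by move=> /eqP; rewrite subr_eq0 => /eqP GD; rewrite -mulrA QG -GD !mulrA GQ.
Qed.

Lemma sub_corner (A : pzRingType) (P D : A) :
  D - (1 - P) * D * (1 - P) = P * D + (D - P * D) * P.
Proof.
rewrite (mulrBl D) mul1r mulrBr mulr1 opprB addrCA addrC; congr (_ + _).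
by rewrite opprB addrC subrK.
Qed.

Section JLattice.
Context {F : numFieldType} {X : normedModType F} {LL : subspaceLattice X}.
Hypothesis hLL : J_subspace_lattice LL.
Implicit Types (A B T Z : Alg LL) (x y : X) (a : F) (K : set X).

Lemma disjoint_lower K x : Jset LL K -> K x -> lower LL K x -> x = 0.
Proof.
move=> JK Kx lx; have [_ _ _ /(_ K JK) h] := hLL.
suff : [set 0] x by [].
by rewrite -h => V [->|->].
Qed.

(** Were K' not inside K_-, it would contain K; then K' is not inside K, so
    K lies in K'_- as well as in K', and K would be zero. *)
Lemma sub_lower K K' : Jset LL K -> Jset LL K' -> K <> K' -> K' `<=` lower LL K.
Proof.
move=> JK JK' KK'; have [LK Kn0 _] := JK; have [LK' _ _] := JK'.
apply: sub_join; split=> // sub.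
case: Kn0; apply/seteqP; split=> [x Kx /=|_ ->]; last first.
  by have [_ ] := member_closed LK.
apply: (disjoint_lower JK') => //; first exact: sub.
suff : K `<=` lower LL K' by apply.
apply: sub_join; split=> // sub'.
by apply: KK'; exact/seteqP.
Qed.

Lemma alg_eq0 A : (forall K, Jset LL K -> forall x, K x -> A x = 0) -> A = 0.
Proof.
move=> A0; apply: algP => x; have [h _ _ _] := hLL.
have : join (Jset LL) x by rewrite h.
exact: (join_sub (ker_closed_subspace A)).
Qed.

Definition central Z : Prop := forall A, Z * A = A * Z.

(** Operators that are scalar on each K of J(L) commute with the algebra on each
    K, and these subspaces span a dense subspace. *)
Lemma central_of_scalar Z :
    (forall K, Jset LL K -> exists a, forall x, K x -> Z x = a *: x) ->
  central Z.
Proof.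
move=> Zscal A; apply/eqP; rewrite -subr_eq0; apply/eqP.
apply: alg_eq0 => K JK x Kx.
have [a Za] := Zscal K JK; rewrite !algE !Za ?alg_opZ ?subrr //.
by apply: alg_invariant => //; have [] := JK.
Qed.

(** A member V of the lattice either contains K, hence y, or is one of the
    subspaces joined in K_-, where g vanishes. *)
Lemma rank_one_exists K y (g : X -> F) : subspaces LL K -> K y ->
  annihilates g (lower LL K) -> exists G : Alg LL, forall x, G x = g x *: y.
Proof.
move=> LK Ky [lg cg g0].
have bg : (fun x => g x *: y) \in bounded_op X.
  apply/bounded_opP; split=> [a u v|x]; first by rewrite lg scalerDl scalerA.
  by apply: cvgZ; [exact: cg|exact: cvg_cst].
have inv : Bop bg \in leaves_invariant LL.
  apply/asboolP => V LV x Vx /=.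
  have [_ V0 Vlin] := member_closed LV.
  have [KV|nKV] := pselect (K `<=` V).
    by rewrite -[_ *: _]addr0; apply: Vlin => //; exact: KV.
  by rewrite g0 ?scale0r //; exact: (@sub_join _ _ _ V) Vx.
by exists (MkAlg inv).
Qed.

Lemma scalar_at0 (g : X -> F) : scalar g -> g 0 = 0.
Proof.
by move=> lg; have := lg (-1) 0 0; rewrite scaler0 addr0 mulN1r addNr.
Qed.

Lemma scalar_atZ (g : X -> F) a x : scalar g -> g (a *: x) = a * g x.
Proof. by move=> lg; rewrite -[_ *: _]addr0 lg (scalar_at0 lg) addr0. Qed.

Definition rank_one_idem K y (g : X -> F) (G : Alg LL) : Prop :=
  [/\ Jset LL K, K y, annihilates g (lower LL K), g y = 1
    & forall x, G x = g x *: y].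

Lemma rank_one_idemK K y g G : rank_one_idem K y g G -> G * G = G.
Proof.
move=> [_ _ [lg _ _] gy Gx]; apply: algP => x; rewrite !algE !Gx.
by rewrite (scalar_atZ _ _ lg) gy mulr1.
Qed.

Lemma finite_rank_mull A T : finite_rank T -> finite_rank (A * T).
Proof.
move=> [n [e Te]]; exists n, (fun i => A (e i)) => x.
have [c Tx] := Te x; exists c.
rewrite algE Tx (big_morph _ (alg_opD A) (alg_op0 A)).
by apply: eq_bigr => i _; rewrite alg_opZ.
Qed.

Lemma finite_rank_mulr A T : finite_rank T -> finite_rank (T * A).
Proof. by move=> [n [e Te]]; exists n, e => x; exact: Te (A x). Qed.

Lemma finite_rankZ a T : finite_rank T -> finite_rank (a *: T).
Proof.
by move=> fT; rewrite -[T]mul1r -alg_scalerAl; exact: finite_rank_mull.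
Qed.

Lemma finite_rankD T T' : 
  finite_rank T -> finite_rank T' -> finite_rank (T + T').
Proof.
move=> [n [e Te]] [m [e' Te']].
exists (n + m)%N,
  (fun i => match fintype.split i with inl j => e j | inr j => e' j end) => x.
have [[c Tx] [c' Tx']] := (Te x, Te' x).
exists (fun i => match fintype.split i with inl j => c j | inr j => c' j end).
rewrite algE Tx Tx' big_split_ord /=; congr (_ + _); apply: eq_bigr => i _.
  by rewrite (unsplitK (inl i)).
by rewrite (unsplitK (inr i)).
Qed.


Context {R : realType} (hF : F = R :> numFieldType \/ F = R[i] :> numFieldType).

Lemma norming_functional K y : Jset LL K -> K y -> y <> 0 ->
  exists2 g, annihilates g (lower LL K) & g y = 1.
Proof.
move=> JK Ky y0; apply: (separation hF); first exact/member_closed/lower_mem.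
by move=> ly; exact/y0/(disjoint_lower JK).
Qed.

Lemma rank_one_idem_exists K y : Jset LL K -> K y -> y <> 0 ->
  exists g G, rank_one_idem K y g G.
Proof.
move=> JK Ky y0; have [g ag gy] := norming_functional JK Ky y0.
have [LK _ _] := JK; have [G GE] := rank_one_exists LK Ky ag.
by exists g, G.
Qed.

(** Induction on the number of vectors spanning the range. If T is not zero
    then, by density, it is not zero on some K of J(L); let y in K be a
    nonzero value of T there, g a functional vanishing on K_- with g y = 1 and G
    the idempotent x |-> g x *: y. Then T - G T has its range in the kernel of
    g, so that one spanning vector fewer is enough, while G T is a combination
    of two rank-one idempotents. *)
Lemma finite_rank_ind (P : Alg LL -> Prop) : P 0 ->
    (forall a A B, P A -> P B -> P (a *: A + B)) ->
    (forall K y g G, rank_one_idem K y g G -> P G) ->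
  forall T, finite_rank T -> P T.
Proof.
move=> P0 Plin Pidem T [n [e Te]]; elim: n => [|n IHn] in e T Te *.
  suff -> : T = 0 by [].
  by apply: algP => x; have [c ->] := Te x; rewrite big_ord0.
have [->//|Tn0] := eqVneq T 0.
have [K [x [JK Kx Tx0]]] : exists K x, [/\ Jset LL K, K x & T x <> 0].
  apply: contrapT => nex; case/eqP: Tn0; apply: alg_eq0 => K JK x Kx.
  by apply: contrapT => Tx0; apply: nex; exists K, x.
have [LK _ _] := JK; have KTx : K (T x) by exact: alg_invariant.
have [g [G idG]] := rank_one_idem_exists JK KTx Tx0.
have [_ _ [lg cg g0] gy GE] := idG; set y := T x in KTx gy GE idG.
(* The functional g \o T - c * g vanishes at y, so adding it to g preserves the
   value 1 there. *)
pose c := g (T y); pose G' := G + (G * T - c *: G).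
have idG' : rank_one_idem K y (fun z => g z + (g (T z) - c * g z)) G'.
  split=> //; last 2 first.
  - by rewrite gy mulr1 subrr addr0.
  - by move=> z; rewrite !algE !GE scalerDl scalerBl scalerA.
  split=> [a u v|z|z lz].
  - by rewrite !(lg, alg_op_comb); ring.
  - apply: cvgD; first exact: cg.
    apply: cvgB; last by apply: cvgM; [exact: cvg_cst|exact: cg].
    exact: (continuous_comp (@alg_continuous _ _ _ T z) (cg (T z))).
  - have lTz : lower LL K (T z) := alg_invariant T (lower_mem K) lz.
    by rewrite (g0 _ lz) (g0 _ lTz) mulr0 subr0 addr0.
have -> : T = G' + ((c - 1) *: G + (T - G * T)).
  apply: algP => z; rewrite !algE scalerBl scale1r.
  rewrite addrACA [G (T z) - _ + _]addrC subrKA [G z + _]addrC subrK.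
  by rewrite addrC subrK.
suff : P (1 *: G' + ((c - 1) *: G + (T - G * T))) by rewrite scale1r.
apply: (Plin _ _ _ (Pidem _ _ _ _ idG')).
apply: (Plin _ _ _ (Pidem _ _ _ _ idG)).
have [c0 yE] := Te x.
have [i0 gi0] : exists i0, g (e i0) != 0.
  apply: contrapT => nex; have : g y = 0.
    rewrite /y yE; elim/big_rec: _ => [|i z _ gz]; first exact: scalar_at0.
    rewrite lg gz addr0.
    have [->|] := eqVneq (g (e i)) 0; first by rewrite mulr0.
    by move=> gei; case: nex; exists i.
  by move/eqP; rewrite gy oner_eq0.
(* Projecting the other e i along e i0 onto the kernel of g fixes every vector
   of that kernel. *)
apply: (IHn (fun i =>
  e (lift i0 i) - (g (e (lift i0 i)) / g (e i0)) *: e i0)) => z.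
have gT'z : g ((T - G * T) z) = 0.
  by rewrite !algE GE -scaleNr addrC lg gy mulr1 addNr.
have [d dE] : exists d : 'I_n.+1 -> F, (T - G * T) z = \sum_i d i *: e i.
  have [d Tz] := Te z; exists (fun i => d i - g (T z) * c0 i).
  rewrite !algE GE /y yE Tz scaler_sumr -sumrB; apply: eq_bigr => i _.
  by rewrite scalerBl scalerA.
exists (fun i => d (lift i0 i)); rewrite dE (bigD1_ord i0) //=.
have gsum : g (\sum_i d i *: e i) = \sum_i d i * g (e i).
  elim/big_rec2: _ => [|i u v _ <-]; first exact: scalar_at0.
  by rewrite lg.
move: gT'z; rewrite dE gsum (bigD1_ord i0) //= => gd.
rewrite [RHS](eq_bigr (fun i => d (lift i0 i) *: e (lift i0 i)
   - (d (lift i0 i) * g (e (lift i0 i)) / g (e i0)) *: e i0)); last first.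
  by move=> i _ /=; rewrite scalerBr scalerA mulrA.
rewrite sumrB -scaler_suml -mulr_suml addrC; congr (_ + _).
rewrite -scaleNr -mulNr; congr (_ *: _).
by rewrite -(addr0_eq gd) opprK mulfK.
Qed.

(** If T u = b u, T v = a v and T (u + v) = c (u + v), then
    (b - c) u + (a - c) v vanishes: either u is a multiple of v or a = b = c. *)
Lemma eigenvectors_scalar T (U : set X) :
    (forall u v, U u -> U v -> U (u + v)) ->
    (forall u, U u -> exists a, T u = a *: u) ->
  exists a, forall u, U u -> T u = a *: u.
Proof.
move=> UD eig.
have [[v [Uv v0]]|none] := pselect (exists v, U v /\ v <> 0); last first.
  exists 0 => u Uu.
  have [->|u0] := eqVneq u 0; first by rewrite alg_op0 scaler0.
  by case: none; exists u; split=> //; exact/eqP.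
have [a Tv] := eig _ Uv; exists a => u Uu.
have [[b Tu] [c Tuv]] := (eig _ Uu, eig _ (UD _ _ Uu Uv)).
have dep : (b - c) *: u + (a - c) *: v = 0.
  by rewrite !scalerBl addrACA -Tu -Tv -alg_opD -opprD -scalerDr -Tuv subrr.
have [bc|bc] := eqVneq b c; last first.
  have -> : u = ((c - a) / (b - c)) *: v.
    apply: (scalerI (a := b - c)); first by rewrite subr_eq0.
    rewrite scalerA mulrCA divff ?subr_eq0 // mulr1 -(opprB a c) scaleNr.
    by apply/eqP; rewrite -addr_eq0 dep eqxx.
  by rewrite alg_opZ Tv !scalerA mulrC.
move/eqP: dep; rewrite bc subrr scale0r add0r scaler_eq0 subr_eq0.
by move=> /orP[/eqP ac|/eqP //]; rewrite Tu bc ac.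
Qed.

Lemma commute_rank_one_eigen T K y g G : rank_one_idem K y g G ->
  T * G = G * T -> T y = g (T y) *: y.
Proof.
move=> [_ _ _ gy GE] TG; rewrite -GE.
by rewrite -[in LHS](scale1r y) -gy -GE -!algME TG.
Qed.

Lemma central_of_commute Z :
    (forall K y g G, rank_one_idem K y g G -> Z * G = G * Z) -> central Z.
Proof.
move=> ZG; apply: central_of_scalar => K JK; have [LK _ _] := JK.
apply: eigenvectors_scalar => [u v Ku Kv|y Ky].
  have [_ _ Klin] := member_closed LK.
  by rewrite -[u]scale1r; exact: Klin.
have [->|/eqP y0] := eqVneq y 0; first by exists 0; rewrite alg_op0 scaler0.
have [g [G idG]] := rank_one_idem_exists JK Ky y0.
by exists (g (Z y)); exact: (commute_rank_one_eigen idG (ZG _ _ _ _ idG)).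
Qed.

Lemma rank_one_idem_finite_rank K y g G :
  rank_one_idem K y g G -> finite_rank G.
Proof.
move=> [_ _ _ _ GE]; exists 1%N, (fun=> y) => x; exists (fun=> g x).
by rewrite big_ord1 GE.
Qed.

(** Write Q = 1 - P and D = delta P. Compressing delta [G, P] = 0 to the corner
    of Q shows that Q D Q commutes with the rank-one idempotents G of that
    corner, so it acts as a scalar lam on the vectors of K killed by P, and as
    some scalar on every other member of J(L). Then Z = Q D Q + lam *: P is
    scalar on K too, hence central, and D - Z has finite rank because D - Q D Q
    has. *)
Lemma lie_derivation_idem (delta : {linear Alg LL -> Alg LL}) K x f P :
    (forall A T, finite_rank T -> delta (lie_bracket A T) =
       lie_bracket (delta A) T + lie_bracket A (delta T)) ->
    rank_one_idem K x f P ->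
  exists2 Z, central Z & finite_rank (delta P - Z).
Proof.
move=> der idP; have PP := rank_one_idemK idP.
have fP := rank_one_idem_finite_rank idP.
have [JK Kx [lf cf f0] fx PE] := idP; have [LK _ _] := JK.
pose Q := 1 - P; pose D := delta P; pose D' := Q * D * Q.
have QP : Q * P = 0 by rewrite /Q mulrBl mul1r PP subrr.
have PQ : P * Q = 0 by rewrite /Q mulrBr mulr1 PP subrr.
have D'P : D' * P = 0 by rewrite /D' -mulrA QP mulr0.
have [_ _ Kcomb] := member_closed LK.
have corner K' y g G : rank_one_idem K' y g G -> f y = 0 -> g x = 0 ->
    D' y = g (D' y) *: y.
  move=> idG fy gx; have [_ _ [lg _ _] gy GE] := idG.
  have PG : P * G = 0.
    apply: algP => z.
    by rewrite !algE GE PE (scalar_atZ _ _ lf) fy mulr0 scale0r.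
  have GP : G * P = 0.
    apply: algP => z.
    by rewrite !algE PE GE (scalar_atZ _ _ lg) gx mulr0 scale0r.
  have GQ : G * Q = G by rewrite /Q mulrBr GP mulr1 subr0.
  have QG : Q * G = G by rewrite /Q mulrBl PG mul1r subr0.
  apply: (commute_rank_one_eigen idG).
  have brk : lie_bracket (delta G) P + lie_bracket G D = 0.
    by rewrite -der // /lie_bracket GP PG subrr linear0.
  exact: (@corner_commute (Alg LL) P Q G D (delta G) QP PQ QG GQ brk).
pose U := [set y | K y /\ f y = 0].
have [lam D'U] : exists lam, forall u, U u -> D' u = lam *: u.
  apply: eigenvectors_scalar => [u v [Ku fu] [Kv fv]|y [Ky fy]].
    rewrite -[u]scale1r; split; first exact: Kcomb.
    by rewrite lf fu fv mulr0 addr0.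
  have [->|/eqP y0] := eqVneq y 0; first by exists 0; rewrite alg_op0 scaler0.
  have [g [lg cg g0] gy] := norming_functional JK Ky y0.
  (* Correcting g by a multiple of f gives an idempotent orthogonal to P. *)
  pose h z := g z - g x * f z.
  have ah : annihilates h (lower LL K).
    split=> [a u v|z|w lw]; rewrite /h.
    - by rewrite lf lg; ring.
    - apply: cvgB; first exact: cg.
      by apply: cvgM; [exact: cvg_cst|exact: cf].
    - by rewrite f0 // g0 // mulr0 subr0.
  have [G GE] := rank_one_exists LK Ky ah.
  exists (h (D' y)); apply: (corner K y h G) => //.
    by split=> //; rewrite /h fy gy mulr0 subr0.
  by rewrite /h fx mulr1 subrr.
exists (D' + lam *: P).
  apply: central_of_scalar => K' JK'.
  have [->|/eqP KK'] := eqVneq K' K.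
    exists lam => z Kz; pose u := z - f z *: x.
    have Uu : U u.
      split; rewrite /u addrC -scaleNr; first exact: Kcomb.
      by rewrite lf fx mulr1 addNr.
    have D'x : D' x = 0.
      transitivity (D' (P x)); first by rewrite PE fx scale1r.
      by rewrite -algME D'P.
    rewrite algDE algZE PE -{1}[z](subrK (f z *: x)) -/u alg_opD D'U //.
    by rewrite alg_opZ D'x scaler0 addr0 -scalerDr subrK.
  have [LK' _ _] := JK'.
  apply: eigenvectors_scalar => [u v K'u K'v|y K'y].
    have [_ _ K'comb] := member_closed LK'.
    by rewrite -[u]scale1r; exact: K'comb.
  have [->|/eqP y0] := eqVneq y 0; first by exists 0; rewrite alg_op0 scaler0.
  have [g [G idG]] := rank_one_idem_exists JK' K'y y0.
  have fy : f y = 0 by apply: f0; apply: (sub_lower JK JK') => // /esym.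
  have gx : g x = 0.
    by have [_ _ [_ _ g0] _ _] := idG; apply: g0; exact: (sub_lower JK' JK).
  exists (g (D' y)); rewrite algDE algZE PE fy scale0r scaler0 addr0.
  exact: corner idG fy gx.
rewrite opprD addrA -scaleNr; apply: finite_rankD; last exact: finite_rankZ.
rewrite -/D /D' /Q sub_corner.
by apply: finite_rankD; [exact: finite_rank_mulr|exact: finite_rank_mull].
Qed.

End JLattice.

(** * Higher Lie derivable families *)

Section LieBracket.
Context {A : pzRingType}.
Implicit Types a b c : A.

Lemma lieC a b : lie_bracket b a = - lie_bracket a b.
Proof. by rewrite /lie_bracket opprB. Qed.

Lemma lieDl c : {morph (fun a => lie_bracket a c) : a b / a + b}.
Proof. by move=> a b; rewrite /lie_bracket mulrDl mulrDr opprD addrACA. Qed.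

Lemma lieDr c : {morph (fun b => lie_bracket c b) : a b / a + b}.
Proof. by move=> a b; rewrite /lie_bracket mulrDl mulrDr opprD addrACA. Qed.

Lemma lie0l c : lie_bracket 0 c = 0.
Proof. by rewrite /lie_bracket mul0r mulr0 subrr. Qed.

Lemma lie0r c : lie_bracket c 0 = 0.
Proof. by rewrite /lie_bracket mul0r mulr0 subrr. Qed.

Lemma lie_suml (I : Type) (r : seq I) (P : pred I) (f : I -> A) c :
  lie_bracket (\sum_(i <- r | P i) f i) c =
  \sum_(i <- r | P i) lie_bracket (f i) c.
Proof. exact: (big_morph (fun a => lie_bracket a c) (lieDl c) (lie0l c)). Qed.

Lemma lie_sumr (I : Type) (r : seq I) (P : pred I) (f : I -> A) c :
  lie_bracket c (\sum_(i <- r | P i) f i) =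
  \sum_(i <- r | P i) lie_bracket c (f i).
Proof. exact: (big_morph (lie_bracket c) (lieDr c) (lie0r c)). Qed.

Lemma lieMnl a c n : lie_bracket (a *+ n) c = lie_bracket a c *+ n.
Proof. by elim: n => [|n IHn]; rewrite ?mulr0n ?lie0l // !mulrSr lieDl IHn. Qed.

Lemma lieMnr a c n : lie_bracket c (a *+ n) = lie_bracket c a *+ n.
Proof. by rewrite lieC lieMnl -mulNrn -lieC. Qed.

End LieBracket.

Lemma sum_triangle (V : nmodType) n (h : nat -> nat -> V) :
  \sum_(i < n.+1) \sum_(k < (n - i).+1) h i k =
  \sum_(k < n.+1) \sum_(i < (n - k).+1) h i k.
Proof.
pose tri (i k : nat) := (i + k <= n)%N.
have triE (f : nat -> V) (i : 'I_n.+1) :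
    \sum_(k < (n - i).+1) f k = \sum_(k < n.+1 | (i + k <= n)%N) f k.
  rewrite (big_ord_widen n.+1 f) ?ltnS ?leq_subr //.
  by apply: eq_bigl => k; rewrite ltnS leq_subRL // -ltnS.
under eq_bigr do rewrite triE.
under [RHS]eq_bigr do rewrite (triE (h^~ _)).
rewrite (exchange_big_dep xpredT) //=; apply: eq_bigr => k _.
by apply: eq_bigl => i; rewrite addnC.
Qed.

Lemma sum_rev (V : nmodType) n (h : nat -> V) :
  \sum_(i < n.+1) h i = \sum_(i < n.+1) h (n - i)%N.
Proof.
rewrite (reindex_inj rev_ord_inj) /=; apply: eq_bigr => i _.
by rewrite subSS.
Qed.

Section LogDerivative.
Context {F : fieldType} {U : lmodType F}.
Variable L : nat -> {linear U -> U}.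
Hypothesis L0 : forall x, L 0%N x = x.

Let step (s : seq (U -> U)) (x : U) : U :=
  (size s).+1%:R *: L (size s).+1 x -
  \sum_(k < size s) L (size s - k)%N (nth id s k x).

(* The list of the first n maps, so that the recursion has access to all the
   previous ones. *)
Let prefix n : seq (U -> U) := iter n (fun s => rcons s (step s)) [::].

Let size_prefix n : size (prefix n) = n.
Proof. by elim: n => //= n IHn; rewrite size_rcons IHn. Qed.

Let nth_prefix n k : (k < n)%N -> nth id (prefix n) k = step (prefix k).
Proof.
elim: n => //= n IHn; rewrite ltnS nth_rcons size_prefix => kn.
by case: ltngtP kn => [/IHn //||-> //].
Qed.

Let d k := step (prefix k).

Let dE n x : d n x = n.+1%:R *: L n.+1 x - \sum_(k < n) L (n - k)%N (d k x).
Proof.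
rewrite {1}/d /step size_prefix; congr (_ - _).
by apply: eq_bigr => k _; rewrite nth_prefix.
Qed.

Let d_linear n : linear (d n).
Proof.
elim/ltn_ind: n => n IHn a x y.
rewrite !dE scalerBr scaler_sumr linearP scalerDr.
under eq_bigr do rewrite IHn // linearP.
by rewrite big_split /= opprD addrACA !scalerA mulrC.
Qed.

(** The k = n term of the sum is delta n itself, as L 0 is the identity: the
    equation can be solved for delta n by recursion. *)
Lemma log_derivative : exists delta : nat -> {linear U -> U}, forall n x,
  n.+1%:R *: L n.+1 x = \sum_(k < n.+1) L (n - k)%N (delta k x).
Proof.
pose delta n : {linear U -> U} :=
  HB.pack (d n) (GRing.isLinear.Build F U U *:%R (d n) (@d_linear n)).
exists delta.
move=> n x /=; rewrite big_ord_recr /= subnn L0 dE.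
by rewrite addrC subrK.
Qed.

End LogDerivative.

Section HigherLie.
Context {F : numFieldType} {X : normedModType F} {LL : subspaceLattice X}.
Variable L : nat -> {linear Alg LL -> Alg LL}.
Implicit Types (A B T Z : Alg LL) (n m : nat).

Definition defect n A B : Alg LL :=
  L n (lie_bracket A B) - \sum_(i < n.+1) lie_bracket (L i A) (L (n - i)%N B).

Lemma defectC n A B : defect n B A = - defect n A B.
Proof.
rewrite /defect [in LHS]lieC linearN opprB addrC; congr (_ + _).
rewrite (sum_rev n (fun i => lie_bracket (L i B) (L (n - i)%N A))) -sumrN.
by apply: eq_bigr => i _; rewrite subKn -1?ltnS // -lieC.
Qed.

Lemma lieZl (a : F) A B : lie_bracket (a *: A) B = a *: lie_bracket A B.
Proof. by rewrite /lie_bracket alg_scalerAl alg_scalerAr scalerBr. Qed.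

Lemma defect_linear n B (a : F) A A' :
  defect n (a *: A + A') B = a *: defect n A B + defect n A' B.
Proof.
rewrite /defect lieDl lieZl linearP scalerBr addrACA -opprD; congr (_ - _).
rewrite scaler_sumr -big_split /=; apply: eq_bigr => i _.
by rewrite linearP lieDl lieZl.
Qed.

Lemma defectDl n B A A' : defect n (A + A') B = defect n A B + defect n A' B.
Proof. by have := defect_linear n B 1 A A'; rewrite !scale1r. Qed.

Lemma defectDr n B A A' : defect n B (A + A') = defect n B A + defect n B A'.
Proof. by rewrite defectC defectDl opprD -!defectC. Qed.

Lemma defect_linearr n B (a : F) A A' :
  defect n B (a *: A + A') = a *: defect n B A + defect n B A'.
Proof. by rewrite defectC defect_linear opprD -scalerN -!defectC. Qed.

Hypothesis L0 : forall A, L 0%N A = A.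
Hypothesis hL : forall n A B, A * B = 0 -> defect n A B = 0.

Lemma defect0 A B : defect 0 A B = 0.
Proof. by rewrite /defect big_ord1 !L0 subrr. Qed.

(** Split B = P B + (1 - P) B on the left-hand side and A = A P + A (1 - P) on
    the right-hand side: the mixed terms are values at zero products. *)
Lemma defect_idem n A B P : P * P = P ->
  defect n (A * P) B = defect n A (P * B).
Proof.
move=> PP.
have : defect n (A * P) (B - P * B) = 0.
  by apply: hL; rewrite mulrBr -!mulrA (mulrA P P) PP subrr.
have : defect n (A - A * P) (P * B) = 0.
  by apply: hL; rewrite mulrBl -!mulrA (mulrA P P) PP subrr.
have <- : defect n (A * P) (P * B) + defect n (A * P) (B - P * B) =
    defect n (A * P) B by rewrite -defectDr addrC subrK.
have <- : defect n (A - A * P) (P * B) + defect n (A * P) (P * B) =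
    defect n A (P * B) by rewrite -defectDl subrK.
by move=> -> ->; rewrite addr0 add0r.
Qed.

Hypothesis hLL : J_subspace_lattice LL.
Context {R : realType} (hF : F = R :> numFieldType \/ F = R[i] :> numFieldType).

(** Idempotents slide across the comma, hence so do all finite
    rank operators; sliding A * T from either side to the other of the unit
    gives two opposite values. *)
Lemma defect_finite_rank n A T : finite_rank T -> defect n A T = 0.
Proof.
have slide : forall S, finite_rank S ->
    forall A, defect n A S = defect n (A * S) 1.
  apply: (finite_rank_ind hLL hF).
  - by move=> A'; rewrite mulr0 !hL ?mulr0 ?mul0r.
  - move=> a S1 S2 IH1 IH2 A'; rewrite defect_linearr IH1 IH2.
    by rewrite mulrDr alg_scalerAr defect_linear.
  - move=> K y g G idG A'.
    by rewrite (defect_idem _ _ _ (rank_one_idemK idG)) mulr1.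
move=> fT; rewrite slide //.
have fAT := finite_rank_mull A fT.
have : defect n (A * T) 1 = - defect n (A * T) 1.
  by rewrite -defectC (slide _ fAT) mul1r.
move/eqP; rewrite -addr_eq0 -mulr2n -scaler_nat scaler_eq0 pnatr_eq0 /=.
by move/eqP.
Qed.

Lemma central_lie A Z : central Z -> lie_bracket Z A = 0.
Proof. by move=> cZ; rewrite /lie_bracket cZ subrr. Qed.

(** By induction, all terms of the Leibniz rule for [Z, G] = 0 with G of finite
    rank vanish except [L_n Z, G]; and an operator commuting with the rank-one
    idempotents is central. *)
Lemma central_image n Z : central Z -> central (L n Z).
Proof.
move=> cZ; elim/ltn_ind: n => n IHn.
apply: (central_of_commute hLL hF) => K y g G idG.
have := defect_finite_rank n Z (rank_one_idem_finite_rank idG).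
rewrite /defect central_lie // linear0 big_ord_recr /= subnn L0 big1 => [|i _].
  by rewrite !add0r => /eqP; rewrite oppr_eq0 subr_eq0 => /eqP.
by rewrite central_lie //; exact: IHn.
Qed.

Lemma defect_central n A Z : central Z -> defect n A Z = 0.
Proof.
move=> cZ; rewrite defectC /defect central_lie // linear0 big1 ?subrr ?oppr0 //.
by move=> i _; rewrite central_lie //; exact: central_image.
Qed.

Definition lie_derivation_on_finite_rank (delta : Alg LL -> Alg LL) : Prop :=
  forall A T, finite_rank T -> delta (lie_bracket A T) =
     lie_bracket (delta A) T + lie_bracket A (delta T).

Lemma defect_derivation (delta : {linear Alg LL -> Alg LL}) n A T :
  lie_derivation_on_finite_rank delta -> finite_rank T ->
  defect n A (delta T) = 0.
Proof.
move=> der; move: T; apply: (finite_rank_ind hLL hF).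
- by rewrite linear0 hL ?mulr0.
- move=> a S1 S2 IH1 IH2.
  by rewrite linearP defect_linearr IH1 IH2 scaler0 addr0.
- move=> K y g G idG.
  have [Z cZ fGZ] := lie_derivation_idem hLL hF der idG.
  rewrite -(subrK Z (delta G)) defectDr defect_finite_rank //.
  by rewrite defect_central // addr0.
Qed.

Lemma defectE n A B :
  \sum_(i < n.+1) lie_bracket (L i A) (L (n - i)%N B) =
  L n (lie_bracket A B) - defect n A B.
Proof. by rewrite /defect opprB addrC subrK. Qed.

Variable delta : nat -> {linear Alg LL -> Alg LL}.
Hypothesis Ldelta : forall n A,
  n.+1%:R *: L n.+1 A = \sum_(k < n.+1) L (n - k)%N (delta k A).

(** This is the coefficient of degree n in the derivative of
    L [A, T] = [L A, L T], with L' = L delta substituted. *)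
Lemma leibniz_finite_rank n A T : finite_rank T ->
  \sum_(k < n.+1) L (n - k)%N (delta k (lie_bracket A T)) =
  \sum_(k < n.+1) L (n - k)%N (lie_bracket (delta k A) T)
  + \sum_(k < n.+1) (L (n - k)%N (lie_bracket A (delta k T))
                     - defect (n - k) A (delta k T)).
Proof.
move=> fT.
have LdeltaMn m B : L m.+1 B *+ m.+1 = \sum_(k < m.+1) L (m - k)%N (delta k B).
  by rewrite -scaler_nat Ldelta.
rewrite -LdeltaMn.
have -> : L n.+1 (lie_bracket A T) =
    \sum_(i < n.+2) lie_bracket (L i A) (L (n.+1 - i)%N T).
  by rewrite defectE defect_finite_rank // subr0.
rewrite -sumrMnl.
have -> : \sum_(i < n.+2) lie_bracket (L i A) (L (n.+1 - i)%N T) *+ n.+1 =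
    \sum_(i < n.+2) lie_bracket (L i A *+ i) (L (n.+1 - i)%N T) +
    \sum_(i < n.+2) lie_bracket (L i A) (L (n.+1 - i)%N T *+ (n.+1 - i)).
  rewrite -big_split /=; apply: eq_bigr => i _.
  by rewrite lieMnl lieMnr -mulrnDr subnKC // -ltnS.
congr (_ + _).
  rewrite big_ord_recl mulr0n lie0l add0r.
  rewrite (sum_rev n (fun i =>
    lie_bracket (L i.+1 A *+ i.+1) (L (n.+1 - i.+1)%N T))).
  transitivity (\sum_(i < n.+1) \sum_(k < (n - i).+1)
      lie_bracket (L (n - i - k)%N (delta k A)) (L i T)).
    apply: eq_bigr => i _; rewrite LdeltaMn lie_suml.
    by apply: eq_bigr => k _; rewrite subSS subKn // -ltnS.
  rewrite (sum_triangle n (fun i k =>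
    lie_bracket (L (n - i - k)%N (delta k A)) (L i T))).
  apply: eq_bigr => k _.
  rewrite -[RHS]subr0.
  rewrite -[X in _ - X](defect_finite_rank (n - k) (delta k A) fT) -defectE.
  rewrite [RHS](sum_rev _ (fun i =>
    lie_bracket (L i (delta k A)) (L (n - k - i)%N T))).
  by apply: eq_bigr => i _; rewrite subKn -1?ltnS // subnAC.
rewrite big_ord_recr /= subnn mulr0n lie0r addr0.
transitivity (\sum_(i < n.+1) \sum_(k < (n - i).+1)
    lie_bracket (L i A) (L (n - i - k)%N (delta k T))).
  by apply: eq_bigr => i _; rewrite subSn -1?ltnS // LdeltaMn lie_sumr.
rewrite (sum_triangle n (fun i k =>
  lie_bracket (L i A) (L (n - i - k)%N (delta k T)))).
apply: eq_bigr => k _; rewrite -defectE.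
by apply: eq_bigr => i _; rewrite subnAC.
Qed.

(** In the expanded derivative, the terms k < n cancel by induction, and in the
    last one L_0 is the identity and the defect of order 0 vanishes. *)
Lemma log_derivative_lie n : lie_derivation_on_finite_rank (delta n).
Proof.
elim/ltn_ind: n => n IHn A T fT.
have := leibniz_finite_rank n A fT.
rewrite !big_ord_recr /= subnn !L0 defect0 subr0.
rewrite addrACA -big_split /= (eq_bigr (fun k : 'I_n => L (n - k)%N
   (lie_bracket (delta k A) T) + (L (n - k)%N (lie_bracket A (delta k T))
                     - defect (n - k) A (delta k T)))); last first.
  move=> k _; have kn := ltn_ord k.
  by rewrite (IHn k kn) // linearD (defect_derivation _ _ (IHn k kn)) // subr0.
exact: addrI.
Qed.

End HigherLie.

Theorem proposition2p7 (R : realType) (F : numFieldType)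
  (hF : F = R :> numFieldType \/ F = R[i] :> numFieldType)
  (X : completeNormedModType F) (LL : subspaceLattice X)
  (hLL : J_subspace_lattice LL)
  (L : nat -> {linear Alg LL -> Alg LL})
  (hL0 : forall A : Alg LL, L 0%N A = A)
  (hL : forall (n : nat) (A B : Alg LL), A * B = 0 ->
     L n (lie_bracket A B) =
       \sum_(i < n.+1) lie_bracket (L i A) (L (n - i)%N B)) :
  exists delta : nat -> {linear Alg LL -> Alg LL},
    (forall (n : nat) (A T : Alg LL), finite_rank T ->
       delta n (lie_bracket A T) =
         lie_bracket (delta n A) T + lie_bracket A (delta n T)) /\
    (forall (n : nat) (A : Alg LL),
       n.+1%:R *: L n.+1 A = \sum_(k < n.+1) L (n - k)%N (delta k.+1 A)).
Proof.
have [d Ld] := log_derivative hL0.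
have vanish n A B : A * B = 0 -> defect L n A B = 0.
  by move=> AB; rewrite /defect hL // subrr.
exists (fun n => d n.-1); split=> // n A T fT.
exact: (log_derivative_lie hL0 vanish hLL hF Ld).
Qed.
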